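(* There exist constants $c, C>0$ such that for all sufficiently large $T$, $$\#\{t<T : \alpha(t) < C\log t\} > T^{c},$$ where $t$ ranges over integers $t\ge 3$.
   Context: Graphs are finite. For a graph $G=(V,E)$, $\tau(G)$ denotes the number of spanning trees of $G$. A graph is simple if it has no loops or multiple edges. For an integer $n\ge 3$, $\mathcal{T}(n) := \{\tau(G) : G=(V,E) \text{ is connected, simple, and planar, and } |V|=n\}$. For an integer $t\ge 3$, $\alpha(t) := \min\{n : t\in\mathcal{T}(n)\}$, i.e. the smallest number of vertices of a planar simple graph with exactly $t$ spanning trees (this is finite since $n\in\mathcal{T}(n)$ for all $n\ge 3$). *)

(* Defs.v *)
From mathcomp Require Import all_boot all_order all_algebra finmap.
From mathcomp Require Import all_classical all_reals all_analysis.

Set Implicit Arguments.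
Unset Strict Implicit.
Unset Printing Implicit Defensive.

Import Order.TTheory GRing.Theory Num.Theory numFieldNormedType.Exports.

Local Open Scope classical_set_scope.
Local Open Scope ring_scope.

Section Graph.
Variable V : finType.

Definition simple_graph (e : rel V) : Prop := symmetric e /\ irreflexive e.

Definition edges (e : rel V) : {set {set V}} :=
  [set [set p.1; p.2] | p : V * V & e p.1 p.2]%SET.

Definition connected_graph (e : rel V) : Prop := forall x y, connect e x y.

(* A [ucycle] of size at most 2 is empty, a loop or a single edge walked back
   and forth; a cycle of a simple graph has at least 3 vertices. *)
Definition acyclic_graph (e : rel V) : Prop :=
  forall s : seq V, ucycle e s -> (size s <= 2)%N.

Definition edge_rel (F : {set {set V}}) : rel V :=
  [rel x y | [set x; y]%SET \in F].

Definition spanning_tree (e : rel V) (F : {set {set V}}) : Prop :=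
  [/\ F \subset edges e, connected_graph (edge_rel F)
    & acyclic_graph (edge_rel F)].

Definition tau (e : rel V) : nat :=
  #|[pred F : {set {set V}} | `[< spanning_tree e F >]]|.

(* A plane drawing: distinct vertices are distinct points of the plane, each
   edge is a simple arc joining its two endpoints, and the interior of an edge
   contains neither a vertex nor a point of another edge. *)
Definition planar (R : realType) (e : rel V) : Prop :=
  exists (p : V -> R * R) (gamma : {set V} -> R -> R * R),
  [/\ injective p,
      forall E, E \in edges e ->
        [/\ {within `[0, 1], continuous (gamma E)},
            {in `[0, 1] &, injective (gamma E)}
          & [set gamma E 0; gamma E 1] = p @` [set` E]],
      forall E, E \in edges e ->
        gamma E @` `]0, 1[ `&` range p = set0
    & forall E F, E \in edges e -> F \in edges e -> E != F ->
        gamma E @` `]0, 1[ `&` gamma F @` `[0, 1] = set0].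

End Graph.

(* This is the set T(n) of the spanning-tree counts of connected simple planar
   graphs on n vertices; the restriction n >= 3 is imposed in [is_alpha]. *)
Definition tree_counts (R : realType) (n : nat) : set nat :=
  [set t | exists (V : finType) (e : rel V),
    [/\ #|V| = n, simple_graph e, connected_graph e, planar R e & tau e = t]].

(* [is_alpha R t a] says that alpha(t) = a. Stated as a relation so that no
   default value is needed in case no n satisfies [tree_counts R n t]. *)
Definition is_alpha (R : realType) (t a : nat) : Prop :=
  [/\ (3 <= a)%N, tree_counts R a t
    & forall n, (3 <= n)%N -> tree_counts R n t -> (a <= n)%N].

(* Main.v *)
Require Import Defs.
From mathcomp Require Import all_boot all_order all_algebra finmap.
From mathcomp Require Import all_classical all_reals all_analysis.
From mathcomp Require Import zify ring lra.

(** The proof exhibits exponentially many spanning-tree counts that all come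
    from planar graphs with the same linear number of vertices.

    The graphs are fans: the path 0 - 1 - ... - n together with some of the
    spokes joining 0 to a later vertex of the path, as prescribed by a word
    [w] of bits. Placing 0 at the origin and [i > 0] at the point [(1, i)],
    and drawing all edges as straight segments, shows that fans are planar
    ([fan_planar]).

    A subgraph of a fan is a spanning tree iff a scan of the path from left to
    right accepts it, where the scan only remembers whether the current vertex
    is already joined to 0 by the part of the subgraph seen so far
    ([fan_treeP]). So the number of spanning trees is a product of 2 x 2
    matrices, one for each letter of [w] ([tau_fan]): the numbers [(x, y)] of
    accepted continuations from the two states become [(x + y, y)] when a
    letter without spoke is put in front of the word, and [(2x + y, x + y)]
    when the letter carries a spoke.

    These two maps are injective and have disjoint images on the pairs with
    [y < x], so the word can be recovered from its pair [(x, y)]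
    ([counts_inj]). To recover it from a single number, put sufficiently many
    spokes in front of [v]: the number of spanning trees becomes [a x + b y]
    with fixed coprime [a] and [b], where [a] exceeds all possible values of
    [y]; hence [y] is determined modulo [a], thus [y] and then [x] are known
    ([fan_count_inj]). With [v] of length [k] and 2(k + 1) leading spokes this
    gives [2 ^ k] distinct counts between [4 ^ k.+1] and [27 ^ k.+1], on
    [3 * k.+1 + 1] vertices each ([many_counts]), and the theorem follows by
    taking [k] proportional to [ln T]. *)

Set Implicit Arguments.
Unset Strict Implicit.
Unset Printing Implicit Defensive.

Import Order.TTheory GRing.Theory Num.Theory numFieldNormedType.Exports.

Local Open Scope classical_set_scope.
Local Open Scope ring_scope.

(** * Edge sets and symmetric relations *)

Lemma set2_eq (V : finType) (x y a b : V) :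
  [set x; y]%SET = [set a; b]%SET -> (x = a /\ y = b) \/ (x = b /\ y = a).
Proof.
move=> E.
have : x \in [set a; b]%SET by rewrite -E set21.
have : y \in [set a; b]%SET by rewrite -E set22.
have : a \in [set x; y]%SET by rewrite E set21.
have : b \in [set x; y]%SET by rewrite E set22.
rewrite !inE => /orP[]/eqP e1 /orP[]/eqP e2 /orP[]/eqP e3 /orP[]/eqP e4.
all: by subst; auto.
Qed.

Lemma edge_rel_edges (V : finType) (e : rel V) : symmetric e ->
  edge_rel (edges e) =2 e.
Proof.
move=> sym_e x y; apply/idP/idP => [|exy]; last first.
  by apply/imsetP; exists (x, y); rewrite ?inE.
case/imsetP => -[a b]; rewrite inE /= => eab /set2_eq[] [-> ->] //.
by rewrite sym_e.
Qed.

Lemma edges_edge_rel (V : finType) (e : rel V) (F : {set {set V}}) :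
  F \subset edges e -> edges (edge_rel F) = F.
Proof.
move=> /fintype.subsetP sFe; apply/setP => E; apply/imsetP/idP => [[p]|EF].
  by rewrite inE /= => ? ->.
by have /imsetP[p pe Ep] := sFe E EF; exists p => //; move: EF; rewrite Ep !inE.
Qed.

Lemma edges_sub (V : finType) (e f : rel V) : subrel e f ->
  edges e \subset edges f.
Proof.
move=> ef; apply: imsetS; apply/fintype.subsetP => -[x y].
by rewrite !inE /=; apply: ef.
Qed.

Lemma eq_edges (V : finType) (e f : rel V) : e =2 f -> edges e = edges f.
Proof.
move=> ef; apply/eqP.
by rewrite finset.eqEsubset !edges_sub // => x y; rewrite ef.
Qed.

Lemma edge_rel_sym (V : finType) (F : {set {set V}}) : symmetric (edge_rel F).
Proof. by move=> x y; rewrite /edge_rel /= finset.setUC. Qed.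

(** * Recognizing trees by a ranking of the vertices *)

(** A vertex of maximal rank on a cycle has two distinct neighbours on it, and
    neither of them has a larger rank. *)
Lemma ranked_acyclic (V : finType) (e : rel V) (rank : V -> nat) :
  symmetric e ->
  (forall x y z, e x y -> e x z ->
     (rank y <= rank x)%N -> (rank z <= rank x)%N -> y = z) ->
  acyclic_graph e.
Proof.
move=> sym_e uniq_low s /andP[cyc_s uniq_s]; rewrite leqNgt; apply/negP => sz_s.
have [x0 x0s] : exists x, x \in s.
  by case: s sz_s {cyc_s uniq_s} => // x s _; exists x; rewrite mem_head.
pose x := [arg max_(x > x0 in s) rank x]%N.
have [xs maxx] : x \in s /\ forall y, y \in s -> (rank y <= rank x)%N.
  by rewrite /x; case: arg_maxnP.
(* Read from a vertex of maximal rank, the cycle is [x, y, .., z]; both [y]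
   and [z] are the low neighbour of [x]. *)
have [i s' rot_s] := rot_to xs.
move: cyc_s uniq_s sz_s.
rewrite -(rot_cycle i) -(rot_uniq i) -(size_rot i) rot_s.
have {maxx} maxx y : y \in s' -> (rank y <= rank x)%N.
  by move=> ys'; apply: maxx; rewrite -(mem_rot i) rot_s inE ys' orbT.
case: s' rot_s maxx => [|y s'] // rot_s maxx.
case: (lastP s') rot_s maxx => [|s'' z] // rot_s maxx.
rewrite /= rcons_path last_rcons mem_rcons !inE.
move=> /and3P[exy _ ezx] /and3P[_ /norP[yz _] _] _.
case/eqP: yz; apply: (uniq_low x);
  rewrite ?maxx // ?inE ?mem_rcons ?inE ?eqxx ?orbT //.
by rewrite sym_e.
Qed.

Lemma ranked_connected (V : finType) (e : rel V) (rank : V -> nat) (r : V) :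
  symmetric e ->
  (forall x, x != r -> exists2 y, e x y & (rank y < rank x)%N) ->
  connected_graph e.
Proof.
move=> sym_e low; have csym := sym_connect_sym sym_e.
suff to_r x : connect e x r.
  by move=> x y; apply: connect_trans (to_r x) _; rewrite csym.
have [n] := ubnP (rank x); elim: n x => // n IH x ltx.
have [->//|xr] := eqVneq x r; have [y exy lt_yx] := low x xr.
by apply: connect_trans (connect1 exy) (IH y _); lia.
Qed.

(** * Scanning words of spokes *)

(** A pair [m] describes how a subgraph of a fan treats a new vertex of the
    path: [m.1] tells whether the edge from the previous vertex is present, and
    [m.2] whether the spoke is. The bit [l] tells whether the previous vertex
    was joined to 0 by the vertices up to it. *)
Definition join_step (l : bool) (m : bool * bool) : bool := m.2 || (m.1 && l).

(** The three conditions say that the spoke exists in the fan ([t]), that no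
    cycle is closed, and that a component that is not yet joined to 0 is not
    abandoned. *)
Definition admissible (l t : bool) (m : bool * bool) : bool :=
  [&& m.2 ==> t, ~~ [&& m.2, m.1 & l] & l || m.1].

Definition all_moves :=
  [:: (false, false); (false, true); (true, false); (true, true)].

Fixpoint tree_codes (l : bool) (w : seq bool) : seq (seq (bool * bool)) :=
  if w is t :: w' then
    flatten [seq [seq m :: c | c <- tree_codes (join_step l m) w']
      | m <- [seq m <- all_moves | admissible l t m]]
  else if l then [:: [::]] else [::].

Lemma uniq_tree_codes l w : uniq (tree_codes l w).
Proof.
elim: w l => [|t w IH] l; first by case: l.
apply: allpairs_uniq_dep => //.
- exact: filter_uniq.
- by case=> m c [m' c'] /= _ _ [-> ->].
Qed.

Definition joined (l : bool) (c : seq (bool * bool)) (k : nat) : bool :=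
  foldl join_step l (take k c).

Notation bits c k := (nth (false, false) c k).

Lemma joined0 c : joined true c 0.
Proof. by rewrite /joined take0. Qed.

Lemma joinedS l c k : (k < size c)%N ->
  joined l c k.+1 = join_step (joined l c k) (bits c k).
Proof.
by move=> ltk; rewrite /joined (take_nth (false, false)) // -cats1 foldl_cat.
Qed.

Lemma mem_tree_codes l w c :
  (c \in tree_codes l w) = [&& size c == size w, joined l c (size c) &
    [forall k : 'I_(size w),
      admissible (joined l c k) (nth false w k) (bits c k)]].
Proof.
elim: w l c => [|t w IH] l [|m c] //=.
- by rewrite /joined /=; case: l => //=; rewrite inE; apply/esym/forallP => -[].
- by case: l => //.
- by apply/negP => /flattenP[? /mapP[m _ ->] /mapP[]].
(* Membership in the concatenation, read off at the first pair. *)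
have -> : (m :: c \in flatten
    [seq [seq m :: c | c <- tree_codes (join_step l m) w]
      | m <- [seq m <- all_moves | admissible l t m]])
   = admissible l t m && (c \in tree_codes (join_step l m) w).
  apply/flatten_mapP/andP => [[m']|[adm cin]].
    by rewrite mem_filter => /andP[adm _] /mapP[c' cin [-> ->]].
  exists m; last by apply/mapP; exists c.
  by rewrite mem_filter adm; case: m {adm cin} => [[] []].
rewrite IH andbCA eqSS; congr (_ && _); rewrite andbCA; congr (_ && _).
apply/andP/forallP => [[adm /forallP admc] [[|k] ltk]|adm].
- by rewrite /joined.
- by have := admc (Ordinal (ltk : (k < size w)%N)).
- split; first by have := adm ord0.
  by apply/forallP => k; have := adm (lift ord0 k).
Qed.

Definition accepted (c : seq (bool * bool)) : Prop :=
  joined true c (size c) /\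
  forall k, (k < size c)%N ->
    ~~ [&& (bits c k).2, (bits c k).1 & joined true c k] /\
    (joined true c k || (bits c k).1).

Lemma tree_codes_accepted w c : c \in tree_codes true w <->
  [/\ size c = size w, accepted c &
    forall k, (k < size w)%N -> (bits c k).2 -> nth false w k].
Proof.
rewrite mem_tree_codes.
split=> [/and3P[/eqP szc last_c /forallP adm]|[szc [last_c adm] le_cw]].
  have {}adm k : (k < size w)%N ->
      admissible (joined true c k) (nth false w k) (bits c k).
    by move=> ltk; have := adm (Ordinal ltk).
  split=> // [|k /adm /and3P[/implyP]//].
  by split=> // k; rewrite szc => /adm /and3P[].
rewrite szc eqxx -{1}szc last_c /=; apply/forallP => k.
have [|nspl lp] := adm k; first by rewrite szc.
by apply/and3P; split=> //; apply/implyP/le_cw.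
Qed.

(** * The number of accepted continuations *)

Definition count_step (s : bool) (u : nat * nat) : nat * nat :=
  ((if s then 2 * u.1 + u.2 else u.1 + u.2)%N,
   (if s then u.1 + u.2 else u.2)%N).

Definition counts (w : seq bool) : nat * nat := foldr count_step (1, 0)%N w.

(** A joined vertex may be followed by an absent edge, by an edge, or by a
    spoke without an edge; an unjoined one must be followed by an edge, with or
    without a spoke. *)
Lemma size_tree_codes w :
  size (tree_codes true w) = (counts w).1 /\
  size (tree_codes false w) = (counts w).2.
Proof.
elim: w => [|t w [IH1 IH2]] //; rewrite /= /all_moves.
by case: t; split;
  rewrite /= ?cats0 ?size_cat !size_map /join_step /= ?IH1 ?IH2; lia.
Qed.

Lemma counts_lt w : ((counts w).2 < (counts w).1)%N.
Proof. by elim: w => [|[] w] //=; case: (counts w) => x y /=; lia. Qed.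

Lemma counts_le w : ((counts w).1 + (counts w).2 <= 3 ^ size w)%N.
Proof.
by elim: w => [|[] w] //=; case: (counts w) => x y /=; rewrite expnS; lia.
Qed.

(** One step maps [(x, y)] with [y < x] to a pair whose difference is [x], and
    whose second component is at least [x] exactly when there is a spoke. *)
Lemma counts_inj v w : size v = size w -> counts v = counts w -> v = w.
Proof.
elim: v w => [|s v IH] [|t w] //= [szvw].
have := counts_lt v; have := counts_lt w; move: (IH w szvw).
case: (counts v) => x y; case: (counts w) => x' y' /= IHw ltw ltv.
case: s; case: t => -[] e1 e2; rewrite ?IHw //;
  first [by congr (_, _); lia | lia].
Qed.

(** The matrix of a letter with a spoke is symmetric with determinant 1, so
    its action on the row [(a, b)] preserves coprimality and at least
    doubles [a]. The leading letter without spoke contributes the row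
    [(1, 1)]. *)
Lemma counts_spokes m : exists a b : nat,
  [/\ coprime a b, (2 ^ m <= a)%N &
   forall w, ((counts (false :: nseq m true ++ w)).1
     = a * (counts w).1 + b * (counts w).2)%N].
Proof.
suff [a [b [cab lea eab]]]: exists a b : nat, [/\ coprime a b, (2 ^ m <= a)%N &
   forall w, ((counts (nseq m true ++ w)).1 + (counts (nseq m true ++ w)).2
     = a * (counts w).1 + b * (counts w).2)%N].
  by exists a, b; split=> // w; rewrite -eab.
elim: m => [|m [a [b [cab lea eab]]]].
  by exists 1%N, 1%N; split => // w; rewrite !mul1n.
exists (2 * a + b)%N, (a + b)%N; split.
- rewrite mul2n -addnn -addnA /coprime gcdnC -[(a + (a + b))%N]addn0.
  by rewrite addn0 gcdnDr gcdnC gcdnDl.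
- by rewrite expnS; lia.
- move=> w; rewrite -addn1 nseqD -catA eab /=; case: (counts w) => x y /=; lia.
Qed.

Lemma fan_count_inj m v w : size v = size w -> (3 ^ size v < 2 ^ m)%N ->
  (counts (false :: nseq m true ++ v)).1 =
    (counts (false :: nseq m true ++ w)).1 ->
  v = w.
Proof.
move=> szvw lt_m; have [a [b [cab lea eab]]] := counts_spokes m.
rewrite !eab => eq_vw; apply: counts_inj => //.
have := counts_le v; have := counts_le w; rewrite -szvw.
move: eq_vw.
case: (counts v) => x y; case: (counts w) => x' y' /= eq_vw lew lev.
have a0 : (0 < a)%N by apply: leq_trans lea; rewrite expn_gt0.
(* Modulo [a] the equation determines [y], because [b] is invertible and
   [y] is smaller than [a]. *)
have yy' : y = y'.
  wlog le_yy : x y x' y' eq_vw lew lev / (y <= y')%N.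
    move=> H; case/orP: (leq_total y y') => [|le]; first exact: (H x y x' y').
    by apply/esym; apply: (H x' y' x y).
  have : (a %| b * (y' - y))%N.
    by apply/dvdnP; exists (x - x')%N; rewrite mulnBr mulnBl; nia.
  rewrite Gauss_dvdr // => /dvdnP[[|q] eq]; first by lia.
  have : (a <= y' - y)%N by rewrite eq; nia.
  lia.
congr (_, _) => //; apply/eqP; rewrite -(eqn_pmul2l a0); apply/eqP.
by move: eq_vw; rewrite yy' => /addIn.
Qed.

Lemma fan_count_ge m w : (2 ^ m <= (counts (false :: nseq m true ++ w)).1)%N.
Proof.
have [a [b [_ lea ->]]] := counts_spokes m; have := counts_lt w.
by nia.
Qed.

(** * Fans and their spanning trees *)

(** The letter with index [k] governs the path edge from [k] to [k.+1] and the
    spoke from 0 to [k.+1]. For [k = 0] these two coincide, hence the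
    assumption below that words start without a spoke. *)
Definition fan_arc (c : seq (bool * bool)) (i j : nat) : bool :=
  ((j == i.+1) && (bits c i).1) || [&& i == 0%N, (0 < j)%N & (bits c j.-1).2].

Definition fan (n : nat) (c : seq (bool * bool)) : rel 'I_n.+1 :=
  [rel x y : 'I_n.+1 | fan_arc c x y || fan_arc c y x].
Arguments fan : clear implicits.

Lemma fan_sym n c : symmetric (fan n c).
Proof. by move=> x y; rewrite /fan /= orbC. Qed.

Lemma fan_irr n c : irreflexive (fan n c).
Proof.
by move=> x; rewrite /fan /= /fan_arc; case: x => x ? /=; apply/negbTE; lia.
Qed.

(** In the tree rooted at 0 that an accepted [c] describes, a joined vertex is
    reached from 0 or from its left neighbour, and an unjoined one from its
    right neighbour. This rank increases away from the root; it is not the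
    distance to 0. *)
Definition fan_rank c i : nat :=
  if joined true c i then i else (size c + size c - i)%N.

Lemma fan_low_neighbor c (x y : 'I_(size c).+1) : accepted c ->
  fan (size c) c x y -> (fan_rank c y <= fan_rank c x)%N ->
  (y : nat) =
    (if joined true c x then if (bits c x.-1).2 then 0 else x.-1 else x.+1)%N.
Proof.
move=> [_ adm].
case: x y => [x ltx] [y lty]; rewrite /fan_rank /fan /= /fan_arc.
move=> /orP[/orP[/andP[/eqP yx px]|/and3P[/eqP x0 y0 sy]]|
            /orP[/andP[/eqP xy py]|/and3P[/eqP y0 x0 sx]]].
- rewrite yx joinedS; last by lia.
  by rewrite /join_step px /=; case: (joined true c x); rewrite ?orbT; lia.
- rewrite x0 joined0; case: y y0 lty sy => // y _ lty sy.
  by rewrite joinedS // /join_step /= sy.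
- rewrite xy /= joinedS /join_step; last by lia.
  have [] := adm y ltac:(lia).
  rewrite py /=.
  by case: (bits c y).2 => //=; case: (joined true c y) => //=; lia.
- by case: x x0 ltx sx => // x _ ltx /= sx; rewrite joinedS // /join_step sx.
Qed.

Lemma accepted_tree c : accepted c ->
  connected_graph (fan (size c) c) /\ acyclic_graph (fan (size c) c).
Proof.
set n := size c => acc_c; have [last_c adm] := acc_c.
pose rank (x : 'I_n.+1) := fan_rank c x.
split; last first.
  apply: (@ranked_acyclic _ _ rank) => [|x y z xy xz lexy lexz].
    exact: fan_sym.
  apply: val_inj => /=.
  by rewrite (fan_low_neighbor acc_c xy lexy) (fan_low_neighbor acc_c xz lexz).
apply: (@ranked_connected _ _ rank ord0) => [|x x0]; first exact: fan_sym.
have {x0} x_gt0 : (0 < x)%N by rewrite lt0n.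
rewrite /rank /fan_rank -/n; case: ifPn => stx.
  have [k xk] : exists k, (x : nat) = k.+1 by exists x.-1; lia.
  have ltk : (k < n)%N by have := ltn_ord x; lia.
  move: stx; rewrite xk joinedS // /join_step.
  case sk: (bits c k).2 => /=.
    by exists ord0; rewrite ?joined0 //= /fan /fan_arc /= xk /= sk !orbT.
  move=> /andP[pk stk].
  have kK : @inord n k = k :> nat by rewrite inordK // ltnW.
  exists (inord k); last by rewrite kK stk.
  by rewrite /fan /fan_arc /= kK xk eqxx pk !orbT.
have ltx : (x < n)%N.
  have := ltn_ord x; rewrite ltnS leq_eqVlt => /predU1P[xn|//].
  by rewrite xn last_c in stx.
have [_] := adm x ltx; rewrite (negbTE stx) /= => px.
exists (inord x.+1); rewrite /fan /fan_arc /= inordK ?eqxx ?px //.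
by case: ifP => _; lia.
Qed.

(** An unjoined vertex that is not connected to its right neighbour belongs to
    a component that does not contain 0. *)
Lemma connected_joined c i : connected_graph (fan (size c) c) ->
  (i <= size c)%N -> ~~ joined true c i -> (i < size c)%N && (bits c i).1.
Proof.
set n := size c => conn lein sti; apply: contraT => bad.
(* [X] consists of [i] and the vertices before it, back to but excluding the
   last joined one; if the edge from [i] to [i.+1] is absent, no edge
   leaves [X]. *)
pose X := [pred j : 'I_n.+1 | (j <= i)%N &&
  [forall k : 'I_n.+1, (j <= k <= i)%N ==> ~~ joined true c k]].
have clX : fingraph.closed (fan n c) X.
  apply: intro_closed; first exact/sym_connect_sym/fan_sym.
  move=> x y xy; rewrite !inE => /andP[lexi /forallP stx].
  have st k : (x <= k <= i)%N -> ~~ joined true c k.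
    move=> lek; have ltk : (k < n.+1)%N by lia.
    by have := stx (Ordinal ltk); rewrite /= lek.
  move: xy; rewrite /fan /= /fan_arc.
  move=> /orP[/orP[/andP[/eqP yx px]|/and3P[/eqP x0 _ _]]|
              /orP[/andP[/eqP xy py]|/and3P[_ x0 sx]]].
  - have neq : (x : nat) <> i.
      by move=> xi; move: bad; rewrite -xi px andbT; have := ltn_ord y; lia.
    apply/andP; split; first by lia.
    by apply/forallP => k; apply/implyP => lek; apply: st; lia.
  - by have := st 0%N; rewrite joined0 x0 leqnn /= => /(_ isT).
  - have sty : ~~ joined true c y.
      have := st x; rewrite leqnn lexi xy joinedS; last first.
        by have := ltn_ord x; lia.
      by move=> /(_ isT); rewrite /join_step py negb_or => /andP[].
    apply/andP; split; first by lia.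
    apply/forallP => k; apply/implyP => lek.
    have [->//|neq] := eqVneq (k : nat) (y : nat).
    by apply: st; lia.
  - have := st x; rewrite leqnn lexi => /(_ isT).
    have -> : (x : nat) = x.-1.+1 by lia.
    by rewrite joinedS ?/join_step ?sx //; have := ltn_ord x; lia.
have := closed_connect clX (conn (inord i) ord0).
rewrite !inE /= inordK // leqnn /= => E.
have : [forall k : 'I_n.+1, (i <= k <= i)%N ==> ~~ joined true c k].
  by apply/forallP => k; apply/implyP; rewrite -eqn_leq => /eqP <-.
by rewrite E => /forallP/(_ ord0); rewrite joined0.
Qed.

Lemma joined_path c k : (k <= size c)%N -> joined true c k ->
  exists q : seq 'I_(size c).+1,
    [/\ path (fan (size c) c) ord0 q, uniq (ord0 :: q), last ord0 q = k :> nat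
      & all (fun j : 'I_(size c).+1 => j <= k)%N q].
Proof.
elim: k => [|k IH] ltk; first by exists [::].
rewrite joinedS // /join_step => /orP[sk|/andP[pk stk]].
  exists [:: inord k.+1]; rewrite /= inE inordK // !andbT; split=> //.
    by rewrite /fan /= /fan_arc inordK // sk !orbT.
  by apply/eqP => /(congr1 val) /=; rewrite inordK.
have [q [path_q uniq_q last_q le_q]] := IH (ltnW ltk) stk.
exists (rcons q (inord k.+1)).
rewrite rcons_path last_rcons inordK // all_rcons inordK //.
rewrite -rcons_cons rcons_uniq uniq_q andbT path_q leqnn /=; split=> //.
- by rewrite /fan /= /fan_arc last_q inordK // eqxx pk.
- rewrite inE negb_or; apply/andP; split.
    by apply/eqP => /(congr1 val) /=; rewrite inordK.
  by apply/negP => /(allP le_q); rewrite inordK // ltnn.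
- by apply: sub_all le_q => j; apply: leqW.
Qed.

Lemma acyclic_joined c k : acyclic_graph (fan (size c) c) -> ~~ (bits c 0).2 ->
  (k < size c)%N -> ~~ [&& (bits c k).2, (bits c k).1 & joined true c k].
Proof.
move=> acy s0 ltk; apply/negP => /and3P[sk pk stk].
have k_gt0 : (0 < k)%N by case: k sk s0 {ltk pk stk} => [->|].
have [q [path_q uniq_q last_q le_q]] := joined_path (ltnW ltk) stk.
(* The path from 0 to [k], the edge to [k.+1] and the spoke back to 0. *)
have /acy : ucycle (fan (size c) c) (ord0 :: rcons q (inord k.+1)).
  apply/andP; split; last first.
    rewrite -rcons_cons rcons_uniq uniq_q andbT inE negb_or; apply/andP; split.
      by apply/eqP => /(congr1 val) /=; rewrite inordK.
    by apply/negP => /(allP le_q); rewrite inordK // ltnn.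
  rewrite /cycle !rcons_path last_rcons path_q /=; apply/andP; split.
    by rewrite /fan /= /fan_arc last_q inordK // eqxx pk.
  by rewrite /fan /= /fan_arc inordK // sk !orbT.
rewrite /= size_rcons; case: q last_q {path_q uniq_q le_q} => //= k0.
by rewrite -k0 in k_gt0.
Qed.

Lemma fan_treeP c : ~~ (bits c 0).2 ->
  (connected_graph (fan (size c) c) /\ acyclic_graph (fan (size c) c)) <->
  accepted c.
Proof.
move=> s0; split=> [[conn acy]|]; last exact: accepted_tree.
split=> [|k ltk].
  by apply: contraT => /(connected_joined conn (leqnn _)); rewrite ltnn.
split; first exact: acyclic_joined.
case stk: (joined true c k) => //=.
by have /andP[] := connected_joined conn (ltnW ltk) (negbT stk).
Qed.

Definition fan_code n (r : rel 'I_n.+1) : seq (bool * bool) :=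
  mkseq (fun k =>
    (r (inord k) (inord k.+1), (0 < k)%N && r ord0 (inord k.+1))) n.

Lemma fan_codeK c : ~~ (bits c 0).2 -> fan_code (fan (size c) c) = c.
Proof.
move=> s0; apply: (@eq_from_nth _ (false, false)) => [|k];
  rewrite size_mkseq // => ltk.
have kK : @inord (size c) k = k :> nat by rewrite inordK // ltnW.
have nk2 : (k == k.+2) = false by lia.
rewrite nth_mkseq // /fan /fan_arc /= kK inordK // eqxx /= nk2.
case: k s0 {ltk kK nk2} => [|k] /=; last first.
  by case: (bits c k.+1) => p s; rewrite ?orbF.
by case: (bits c 0) => p [] //; rewrite !orbF.
Qed.

Lemma fan_codeE n c (r : rel 'I_n.+1) : symmetric r -> subrel r (fan n c) ->
  fan n (fan_code r) =2 r.
Proof.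
move=> sym_r sub_r.
(* By symmetry only the pairs [x < y] matter. *)
suff arcE (x y : 'I_n.+1) : (x < y)%N -> fan_arc (fan_code r) x y = r x y.
  have arcN (x y : 'I_n.+1) : (x <= y)%N -> fan_arc (fan_code r) y x = false.
    by move=> lexy; rewrite /fan_arc; apply/negbTE; lia.
  move=> x y; rewrite /fan /=; case: (ssrnat.ltngtP x y) => [lt|lt|/val_inj ->].
  - by rewrite arcE // arcN ?orbF // ltnW.
  - by rewrite (arcE y x) // arcN ?orbF // 1?ltnW // sym_r.
  - by rewrite arcN //; apply/esym/negP => /sub_r; rewrite fan_irr.
move=> ltxy; have lty := ltn_ord y.
rewrite /fan_arc /fan_code !nth_mkseq; try lia.
rewrite inord_val; have [yx|nyx] := eqVneq (y : nat) x.+1.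
  rewrite -yx inord_val /=.
  have [x0|] := eqVneq (x : nat) 0%N; last by rewrite orbF.
  by rewrite yx x0 /= orbF.
have [x0|nx0] := eqVneq (x : nat) 0%N => /=.
  have -> : (0 < y)%N by lia.
  have -> : (0 < y.-1)%N by lia.
  rewrite prednK; last by lia.
  by rewrite inord_val; congr (r _ _); apply: val_inj; rewrite /= x0.
apply/esym/negP => /sub_r; rewrite /fan /= /fan_arc; lia.
Qed.

(** Reading off the bits is a bijection from the subgraphs of the fan to the
    bit lists bounded by [w]; by [fan_treeP] it restricts to a bijection from
    the spanning trees to the accepted lists. *)
Lemma tau_fan w : ~~ nth false w 0 ->
  tau (fan (size w) [seq (true, t) | t <- w]) = (counts w).1.
Proof.
move=> w0; set e := fan _ _; have [<- _] := size_tree_codes w.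
pose toF c := edges (fan (size w) c).
have spokeN0 c : c \in tree_codes true w -> ~~ (bits c 0).2.
  move=> /tree_codes_accepted[szc _ le_cw]; apply/negP => c0.
  move/negP: w0; apply; apply: le_cw => //.
  by case: c c0 szc => // m c _ <-.
have injF : {in tree_codes true w &, injective toF}.
  apply: (can_in_inj (g := fun F => fan_code (edge_rel F))) => c cin.
  have [szc _ _] := iffLR (tree_codes_accepted _ _) cin.
  have -> : edge_rel (toF c) = fan (size w) c.
    by apply: funext => x; apply: funext => y; apply/edge_rel_edges/fan_sym.
  by rewrite -szc fan_codeK // spokeN0.
have uF : uniq (map toF (tree_codes true w)).
  by rewrite map_inj_in_uniq // uniq_tree_codes.
rewrite -(size_map toF) -(card_uniqP uF) /tau; apply: eq_card => F.
rewrite inE; apply/asboolP/mapP => [[sFe conn acy]|[c cin ->]].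
  have symF : symmetric (edge_rel F) by exact: edge_rel_sym.
  have subF : subrel (edge_rel F) e.
    move=> x y xyF; rewrite -[e x y](edge_rel_edges (@fan_sym _ _)).
    exact: (fintype.subsetP sFe).
  have decE := fan_codeE symF subF.
  have szd : size (fan_code (edge_rel F)) = size w by rewrite size_mkseq.
  exists (fan_code (edge_rel F)); last first.
    by rewrite /toF (eq_edges decE) (edges_edge_rel sFe).
  apply/tree_codes_accepted; split=> //.
    apply/fan_treeP; last rewrite szd.
      by case: (size w) (edge_rel F).
    by have -> : fan (size w) (fan_code (edge_rel F)) = edge_rel F
      by apply: funext => x; apply: funext.
  move=> k ltk; rewrite nth_mkseq //= => /andP[k0 /subF].
  rewrite /e /fan /= /fan_arc inordK //=.
  by case: k ltk k0 => // k ltk _; rewrite /= orbF (nth_map false).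
have [szc acc_c le_cw] := iffLR (tree_codes_accepted _ _) cin.
have /fan_treeP : ~~ (bits c 0).2 by exact: spokeN0.
rewrite szc => -[_ /(_ acc_c)[conn acy]].
have tF : edge_rel (toF c) = fan (size w) c.
  by apply: funext => x; apply: funext => y; apply/edge_rel_edges/fan_sym.
split; rewrite ?tF //; apply: edges_sub => x y.
have sub_arc (i j : nat) : (j <= size w)%N -> fan_arc c i j ->
    fan_arc [seq (true, t) | t <- w] i j.
  move=> lej; rewrite /fan_arc => /orP[/andP[/eqP ji pi]|/and3P[-> j0 sj]].
    by rewrite ji in lej *; rewrite eqxx (nth_map false).
  have ltj : (j.-1 < size w)%N by lia.
  by rewrite j0 [X in X.2](nth_map false) /= ?le_cw ?orbT.
have := ltn_ord x; have := ltn_ord y; rewrite !ltnS => lex ley.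
by rewrite /e /fan /= => /orP[/sub_arc->//|/sub_arc->//]; rewrite orbT.
Qed.

(** * Drawing fans in the plane *)

Section Drawing.
Variables (R : realType) (n : nat).
Implicit Types E F : {set 'I_n.+1}.

Definition vertex_point (i : 'I_n.+1) : R * R :=
  if i == ord0 then (0, 0) else (1, i%:R).

Definition spoke (k : nat) (t : R) : R * R := (t, t * k%:R).

Definition rung (k : nat) (t : R) : R * R := (1, k%:R + t).

(** In a fan, an edge is determined by its larger endpoint and by whether it
    contains 0. *)
Definition curve (E : {set 'I_n.+1}) : R -> R * R :=
  let k := (\max_(i in E) (i : nat))%N in
  if ord0 \in E then spoke k else rung k.-1.

Definition drawn_edge (E : {set 'I_n.+1}) (g : R -> R * R) : Prop :=
  (exists k : 'I_n.+1, [/\ (0 < k)%N, E = [set ord0; k]%SET & g = spoke k]) \/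
  (exists j k : 'I_n.+1,
    [/\ (0 < j)%N, (k : nat) = j.+1, E = [set j; k]%SET & g = rung j]).

Lemma max_set2 (j k : 'I_n.+1) : (j < k)%N ->
  (\max_(i in [set j; k]%SET) (i : nat))%N = k.
Proof.
move=> ltjk; have jk : j \notin [set k]%SET.
  by rewrite inE; apply/eqP => jk; rewrite jk ltnn in ltjk.
rewrite big_setU1 //= big_set1; lia.
Qed.

Lemma drawn_edgeP c E : E \in edges (fan n c) -> drawn_edge E (curve E).
Proof.
suff H (i j : 'I_n.+1) : fan_arc c i j ->
    drawn_edge [set i; j]%SET (curve [set i; j]%SET).
  case/imsetP => -[x y]; rewrite inE /fan /= => /orP[/H xy ->//|/H yx ->].
  by rewrite finset.setUC.
move=> ij; have ltij : (i < j)%N by move: ij; rewrite /fan_arc; lia.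
rewrite /curve max_set2 // !inE.
have [i0|i0] := eqVneq ord0 i.
  by left; exists j; rewrite -i0; split=> //; lia.
right; exists i, j.
have i_gt0 : (0 < i)%N.
  rewrite lt0n; apply: contra i0 => /eqP i0.
  by apply/eqP/val_inj; rewrite /= i0.
have ji : (j : nat) = i.+1 by move: ij; rewrite /fan_arc; lia.
by split; rewrite // ji /=; case: eqP => // j0; rewrite -j0 in ji.
Qed.

(** Unit segments between consecutive integer points do not overlap: an
    interior point of one lies on no other. *)
Lemma nat_gap (j k : nat) (s t : R) :
  j%:R + s = k%:R + t -> 0 < s < 1 -> 0 <= t <= 1 -> j = k.
Proof.
move=> e s01 t01.
have : (j%:R < k.+1%:R :> R) by rewrite -natr1; lra.
have : (k%:R < j.+1%:R :> R) by rewrite -natr1; lra.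
by rewrite !ltr_nat; lia.
Qed.

Lemma point_spoke k t i : 0 < t < 1 -> vertex_point i != spoke k t.
Proof.
move=> t01; rewrite /vertex_point /spoke; apply/eqP.
by case: ifP => _ [] e1 e2; lra.
Qed.

Lemma point_rung k t i : 0 < t < 1 -> vertex_point i != rung k t.
Proof.
move=> t01; rewrite /vertex_point /rung; apply/eqP.
case: ifP => _ []; first by move=> e1 e2; lra.
move=> e; have ik : k = i by apply: (@nat_gap _ _ t 0); lra.
by move: e; rewrite ik; lra.
Qed.

Lemma spoke_continuous k : continuous (spoke k).
Proof.
move=> t; apply: (@cvg_pair _ _ _ (nbhs t) (nbhs t) (nbhs (t * k%:R))).
  exact: cvg_id.
by apply: cvgM; [exact: cvg_id | exact: cvg_cst].
Qed.

Lemma rung_continuous k : continuous (rung k).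
Proof.
move=> t; apply: (@cvg_pair _ _ _ (nbhs t) (nbhs (1 : R)) (nbhs (k%:R + t))).
  exact: cvg_cst.
by apply: cvgD; [exact: cvg_cst | exact: cvg_id].
Qed.

Lemma image_points (i j : 'I_n.+1) :
  vertex_point @` [set` [set i; j]%SET] =
    [set vertex_point i; vertex_point j].
Proof.
apply/seteqP; split=> [_ [k /= + <-]|_ [|] ->].
- by rewrite !inE => /orP[]/eqP ->; [left | right].
- by exists i; rewrite //= !inE eqxx.
- by exists j; rewrite //= !inE eqxx orbT.
Qed.

Lemma fan_planar c : planar R (fan n c).
Proof.
exists vertex_point, curve; split.
- move=> i j; rewrite /vertex_point.
  case: eqP => [->|_]; case: eqP => [->|_] //.
  + by move=> [/eqP]; rewrite eq_sym oner_eq0.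
  + by move=> [/eqP]; rewrite oner_eq0.
  + by move=> [/eqP]; rewrite eqr_nat => /eqP/val_inj.
- move=> E /drawn_edgeP[[k [k0 -> ->]]|[j [k [j0 kj -> ->]]]]; split.
  + by apply: continuous_subspaceT => t; apply: spoke_continuous.
  + by move=> s t _ _ [].
  + rewrite image_points /vertex_point /spoke eqxx mul0r mul1r.
    by case: eqP k0 => // ->.
  + by apply: continuous_subspaceT => t; apply: rung_continuous.
  + by move=> s t _ _ [] /addrI.
  + rewrite image_points /vertex_point /rung addr0 natr1 kj.
    by case: eqP j0 => [->//|_ _]; case: eqP kj => [->|].
- move=> E /drawn_edgeP H; rewrite -subset0 => _ [[t /= + <-] [i _ e]].
  rewrite in_itv /= => t01.
  case: H e => [[k [_ _ ->]]|[j [k [_ _ _ ->]]]]; apply/eqP.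
  + exact: point_spoke.
  + exact: point_rung.
- move=> E F /drawn_edgeP HE /drawn_edgeP HF; rewrite -subset0.
  move=> EF _ [[t /= + <-] [s /= + e]].
  rewrite !in_itv /= => t01 s01.
  case: HE e => [[k [k0 Ek ->]]|[j [k [j0 kj Ek ->]]]];
  case: HF => [[k' [k0' Fk ->]]|[j' [k' [j0' kj' Fk ->]]]] => -[].
  + move=> -> e; case/eqP: EF; rewrite Ek Fk; congr [set _; _]%SET.
    apply: val_inj; apply/eqP; rewrite -(eqr_nat R); apply/eqP.
    by apply: (@mulfI _ t); [lra|].
  + by move=> e; lra.
  + move=> es e; have kk : j = k' :> nat.
      by apply: (@nat_gap _ _ t 0); move: e; rewrite es; lra.
    by move: e; rewrite es kk; lra.
  + move=> e; have jj : j = j' :> nat.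
      by apply: (@nat_gap _ _ t s) => //; rewrite e.
    case/eqP: EF; rewrite Ek Fk; congr [set _; _]%SET; apply: val_inj => //.
    by rewrite /= kj kj' jj.
Qed.

End Drawing.

(** * Many spanning-tree counts on few vertices *)

Lemma fan_tree_counts (R : realType) w : ~~ nth false w 0 ->
  tree_counts R (size w).+1 (counts w).1.
Proof.
move=> w0.
exists 'I_(size w).+1, (fan (size w) [seq (true, t) | t <- w]); split.
- exact: card_ord.
- by split; [exact: fan_sym | exact: fan_irr].
- have : (0 < tau (fan (size w) [seq (true, t) | t <- w]))%N.
    by rewrite tau_fan // (leq_ltn_trans _ (counts_lt w)).
  case/card_gt0P => F; rewrite inE => -[sFe conn _] x y.
  apply: (connect_sub _ (conn x y)) => a b abF; apply: connect1.
  rewrite -(edge_rel_edges (@fan_sym _ _)); exact: (fintype.subsetP sFe).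
- exact: fan_planar.
- exact: tau_fan.
Qed.

Lemma alpha_le (R : realType) t n : (3 <= n)%N -> tree_counts R n t ->
  exists2 a, is_alpha R t a & (a <= n)%N.
Proof.
move=> n3 tn.
have ex : exists n, `[< (3 <= n)%N /\ tree_counts R n t >].
  by exists n; apply/asboolP.
case: (ex_minnP ex) => a /asboolP[a3 ta] min_a.
exists a; last by apply/min_a/asboolP.
by split=> // m m3 tm; apply/min_a/asboolP.
Qed.

Lemma many_counts (R : realType) k : exists s : seq nat,
  [/\ uniq s, size s = (2 ^ k)%N &
    forall t, t \in s ->
      [/\ (4 ^ k.+1 <= t)%N, (t <= 27 ^ k.+1)%N &
        tree_counts R (3 * k.+1).+1 t]].
Proof.
pose m := (2 * k.+1)%N.
pose trees (v : k.-tuple bool) := (counts (false :: nseq m true ++ v)).1.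
exists (map trees (enum {: k.-tuple bool})); split.
- (* 3 ^ k < 4 ^ k.+1 = 2 ^ m *)
  rewrite map_inj_uniq ?enum_uniq // => v v' eq_vv'.
  apply: val_inj; apply: (@fan_count_inj m) eq_vv'; rewrite !size_tuple //.
  rewrite /m expnM.
  by apply: leq_trans (_ : 3 ^ k.+1 <= _)%N; rewrite ?ltn_exp2l // leq_exp2r.
- by rewrite size_map -cardE card_tuple card_bool.
- move=> t /mapP[v _ ->]; rewrite /trees; set w := (false :: _).
  have szw : size w = (3 * k.+1)%N.
    by rewrite /w /= size_cat size_nseq size_tuple /m; lia.
  split; last by rewrite -szw; exact: fan_tree_counts.
    by rewrite (_ : 4 = 2 ^ 2)%N // -expnM; exact: fan_count_ge.
  rewrite (_ : 27 = 3 ^ 3)%N // -expnM -szw.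
  exact: leq_trans (leq_addr _ _) (counts_le w).
Qed.

Theorem theorem1p6 (R : realType) :
  exists c C : R, [/\ 0 < c, 0 < C &
    \forall T \near +oo,
      T `^ c < #|` fset_set [set t : nat | [/\ (3 <= t)%N, t%:R < T &
                 exists2 a, is_alpha R t a & a%:R < C * ln t%:R]] |%:R].
Proof.
have ln2 : 0 < ln 2 :> R by rewrite ln_gt0 // ltr1n.
have ln4 : 0 < ln 4 :> R by rewrite ln_gt0 // ltr1n.
have ln27 : 0 < ln 27 :> R by rewrite ln_gt0 // ltr1n.
exists (ln 2 / (4 * ln 27)), (5 / ln 4); split.
- by rewrite divr_gt0 // mulr_gt0.
- by rewrite divr_gt0.
exists (27 ^+ 3); split; first exact: num_real.
move=> T ltT.
have T0 : 0 < T by apply: lt_trans ltT; rewrite exprn_gt0.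
set x := ln T / ln 27.
have x3 : 3 < x.
  rewrite /x ltr_pdivlMr // -[X in X * _]/(3%:R) mulr_natl -lnXn //.
  by rewrite ltr_ln ?posrE ?exprn_gt0.
(* The choice of [k] gives 27 ^ k.+1 < T, while
   c * ln T = x / 4 * ln 2 < k * ln 2. *)
have [k [k0 lekx ltxk]] : exists k,
    [/\ (0 < k)%N, k%:R + 2 <= x & x < k%:R + 3].
  have x0 : 0 <= x by lra.
  have /andP[le lt] := truncn_itv x0.
  have m3 : (3 <= Num.truncn x)%N by rewrite truncn_ge_nat //; lra.
  exists (Num.truncn x - 2)%N; rewrite natrB; last by lia.
  by split; [lia | lra | rewrite -natr1 in lt; lra].
have [s [uniq_s size_s sP]] := many_counts R k.
set X := [set t : nat | _].
have finX : finite_set X.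
  apply: (sub_finite_set _ (finite_II (Num.truncn T).+1)) => t [_ ltT' _] /=.
  by rewrite ltnS truncn_ge_nat ltW.
have sX : {subset s <= X}.
  move=> t ts; have [le_t t_le tc] := sP t ts.
  have [|a alpha_a le_a] := alpha_le _ tc; first by lia.
  have t4 : (4 <= t)%N.
    by apply: leq_trans le_t; rewrite -{1}(expn1 4) leq_exp2l.
  apply/mem_set; split.
  - by lia.
  - apply: le_lt_trans (_ : (27 ^ k.+1)%:R < _); first by rewrite ler_nat.
    rewrite -ltr_ln ?posrE ?ltr0n ?expn_gt0 // natrX lnXn //.
    rewrite -[_ *+ k.+1]mulr_natl.
    by rewrite -ltr_pdivlMr // -natr1 -/x; lra.
  - exists a => //; apply: le_lt_trans (_ : (3 * k.+1).+1%:R < _).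
      by rewrite ler_nat.
    have : ln (4 ^ k.+1)%:R <= ln t%:R :> R.
      by rewrite ler_ln ?posrE ?ltr0n ?expn_gt0 // ?ler_nat //; lia.
    rewrite natrX lnXn // -[_ *+ k.+1]mulr_natl -ler_pdivlMr // => lek.
    rewrite mulrAC -mulrA.
    apply: lt_le_trans (_ : 5 * k.+1%:R <= _); last first.
      by rewrite ler_pM2l.
    by rewrite -natrM ltr_nat; lia.
apply: lt_le_trans (_ : (2 ^ k)%:R <= _).
  rewrite natrX -ltr_ln ?posrE ?powR_gt0 ?exprn_gt0 // ln_powR lnXn //.
  rewrite -[_ *+ k]mulr_natl.
  have -> : ln 2 / (4 * ln 27) * ln T = x / 4 * ln 2.
    by rewrite /x; field; rewrite gt_eqF.
  rewrite ltr_pM2r //.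
  have : 1 <= k%:R :> R by rewrite ler1n.
  lra.
rewrite ler_nat -size_s -(undup_id uniq_s) -card_fseq.
apply: fsubset_leq_card; apply/fsubsetP => t; rewrite in_fset /= => ts.
by rewrite in_fset_set // sX.
Qed.
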